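(* Let $n,k\ge 1$ be integers and let $A_1,\dots,A_k,B_1,\dots,B_k,C\in\mathcal{M}_n(\mathbb{C})$ be such that $\mathcal{N}=\{A_1,\dots,A_k,B_1,\dots,B_k,C\}$ is a commuting set of diagonalizable matrices, and assume that the equation $$(E)\qquad \sum_{j=1}^kA_jXB_j=C$$ with unknown $X\in\mathcal{M}_n(\mathbb{C})$ is consistent. Let $S\in\mathfrak{S}(\mathcal{N})$, let $\Gamma^S$ be the relevant matrix with respect to $S$, let $\widehat{X}=\big(\sum_{j=1}^kA_jB_j\big)^{\mathbf{D}}C$, and let $$\mathcal{X}_h=S\{Y=[y_{rs}]\in\mathcal{M}_n(\mathbb{C})\mid y_{rs}=0\text{ if }\Gamma^S_{rs}\neq 0\}S^{-1}.$$ The following statements are valid. (i) The set of solutions of $(E)$ is the affine set $\mathcal{X}=\widehat{X}+\mathcal{X}_h$ obtained by translating the subspace $\mathcal{X}_h\subset\mathcal{M}_n(\mathbb{C})$ with the matrix $\widehat{X}$. (ii) $\widehat{X}$ is the unique solution of $(E)$ if and only if all entries of the relevant matrix $\Gamma^S$ are non-zero. (iii) If the standard linear matrix equation $\big(\sum_{j=1}^kA_jB_j\big)X=C$ has an infinite number of solutions, then $(E)$ has an infinite number of solutions. (iv) If all off-diagonal elements of the relevant matrix $\Gamma^S$ are non-zero, then $\mathcal{N}\cup\mathcal{X}$ is a commuting set of diagonalizable matrices and all matrices in $\mathcal{X}$ are solutions of the standard linear matrix equation $\big(\sum_{j=1}^kA_jB_j\big)X=C$.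
   Context: $\mathcal{M}_n(\mathbb{C})$ is the set of complex $n\times n$ matrices. A set of matrices is commuting if any two of its elements commute. An equation is consistent if it has at least one solution. For a diagonalizable $M\in\mathcal{M}_n(\mathbb{C})$, $\mathfrak{S}(M)$ is the set of invertible $S\in\mathcal{M}_n(\mathbb{C})$ such that $S^{-1}MS$ is diagonal, and for $S\in\mathfrak{S}(M)$, $\Delta_M(S)\in\mathbb{C}^n$ is the vector $\mathbf{m}$ with $\mathrm{diag}(\mathbf{m})=S^{-1}MS$. For a set $\mathcal{N}$ of diagonalizable matrices, $\mathfrak{S}(\mathcal{N})=\bigcap_{M\in\mathcal{N}}\mathfrak{S}(M)$ (nonempty when $\mathcal{N}$ is a commuting set). For $S\in\mathfrak{S}(\mathcal{N})$ put $\mathbf{a}^j=\Delta_{A_j}(S)=(a^j_1,\dots,a^j_n)$ and $\mathbf{b}^j=\Delta_{B_j}(S)=(b^j_1,\dots,b^j_n)$; the relevant matrix with respect to $S$ is $\Gamma^S\in\mathcal{M}_n(\mathbb{C})$ with entries $\Gamma^S_{rs}=\sum_{j=1}^ka^j_rb^j_s$. The Drazin inverse $A^{\mathbf{D}}$ of $A\in\mathcal{M}_n(\mathbb{C})$ is the unique matrix with $A^{p+1}A^{\mathbf{D}}=A^{p}$, $A^{\mathbf{D}}AA^{\mathbf{D}}=A^{\mathbf{D}}$, $A^{\mathbf{D}}A=AA^{\mathbf{D}}$, where $p=\mathrm{ind}(A)$ is the least nonnegative integer with $\mathrm{rank}(A^{p+1})=\mathrm{rank}(A^p)$. *)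

(* Defs.v *)
From mathcomp Require Import all_boot all_order all_algebra complex.
From mathcomp Require Import boolp classical_sets functions cardinality reals.

Set Implicit Arguments.
Unset Strict Implicit.
Unset Printing Implicit Defensive.

Import GRing.Theory.

Local Open Scope classical_set_scope.
Local Open Scope ring_scope.

Section MatrixEquation.
Context {F : fieldType}.
Implicit Types n k : nat.

Definition commuting_set n (N : set 'M[F]_n) : Prop :=
  forall M1 M2, N M1 -> N M2 -> comm_mx M1 M2.

Definition diagonalizable_set n (N : set 'M[F]_n) : Prop :=
  forall M, N M -> diagonalizable M.

Definition diagonalizers n (M : 'M[F]_n) : set 'M[F]_n :=
  [set S | S \in unitmx /\ is_diag_mx (invmx S *m M *m S)].

Definition codiagonalizers n (N : set 'M[F]_n) : set 'M[F]_n :=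
  \bigcap_(M in N) diagonalizers M.

Definition diag_vec n (M S : 'M[F]_n) : 'rV[F]_n :=
  \row_i (invmx S *m M *m S) i i.

Lemma diag_vecP n (M S : 'M[F]_n) :
  diagonalizers M S -> diag_mx (diag_vec M S) = invmx S *m M *m S.
Proof.
case=> _ /is_diag_mxP dS; apply/matrixP => i j; rewrite !mxE.
have [->|ij] := eqVneq i j; first by rewrite mulr1n.
by rewrite mulr0n -[LHS](dS _ _ ij) !mxE.
Qed.

Definition coef_set n k (A B : 'I_k -> 'M[F]_n) (C : 'M[F]_n) : set 'M[F]_n :=
  range A `|` range B `|` [set C].

Definition relevant_mx n k (A B : 'I_k -> 'M[F]_n) (S : 'M[F]_n) : 'M[F]_n :=
  \matrix_(r, s) \sum_(j < k) diag_vec (A j) S 0 r * diag_vec (B j) S 0 s.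

Definition solutions n k (A B : 'I_k -> 'M[F]_n) (C : 'M[F]_n) : set 'M[F]_n :=
  [set X | \sum_(j < k) A j *m X *m B j = C].

Definition coef_prod n k (A B : 'I_k -> 'M[F]_n) : 'M[F]_n :=
  \sum_(j < k) A j *m B j.

Definition std_solutions n k (A B : 'I_k -> 'M[F]_n) (C : 'M[F]_n) :
    set 'M[F]_n :=
  [set X | coef_prod A B *m X = C].

Definition hom_space n k (A B : 'I_k -> 'M[F]_n) (S : 'M[F]_n) : set 'M[F]_n :=
  [set S *m Y *m invmx S | Y in
    [set Y : 'M[F]_n | forall r s, relevant_mx A B S r s != 0 -> Y r s = 0]].

Lemma ex_index n (A : 'M[F]_n) : exists p, \rank (A ^+ p.+1) == \rank (A ^+ p).
Proof.
suff H m p : (\rank (A ^+ p) <= m)%N ->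
    exists p, \rank (A ^+ p.+1) == \rank (A ^+ p) by exact: (H n 0 (rank_leq_row _)).
elim: m p => [|m IH] p rp; have := mxrankM_maxr A (A ^+ p);
  rewrite -[A *m _]/(A * A ^+ p) -exprS leq_eqVlt => /orP[e|lt]; try by exists p.
  by move: (leq_trans lt rp).
exact: (IH p.+1 (leq_trans lt rp)).
Qed.

Definition mx_index n (A : 'M[F]_n) : nat := ex_minn (ex_index A).

Lemma mx_indexP n (A : 'M[F]_n) :
  \rank (A ^+ (mx_index A).+1) = \rank (A ^+ mx_index A) /\
  forall q, \rank (A ^+ q.+1) = \rank (A ^+ q) -> (mx_index A <= q)%N.
Proof.
rewrite /mx_index; case: ex_minnP => p /eqP rp pmin.
by split=> // q /eqP; apply: pmin.
Qed.

Definition is_drazin n (A D : 'M[F]_n) : Prop :=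
  [/\ A ^+ (mx_index A).+1 *m D = A ^+ mx_index A,
      D *m A *m D = D
    & D *m A = A *m D].

Definition drazin n (A : 'M[F]_n) : 'M[F]_n := xget 0 [set D | is_drazin A D].

Lemma ring_drazin_exists (R : pzRingType) (a y z : R) p :
  y * a ^+ p.+1 = a ^+ p -> a ^+ p.+1 * z = a ^+ p ->
  exists d, [/\ a ^+ p.+1 * d = a ^+ p, d * a * d = d & d * a = a * d].
Proof.
move=> hy hz.
have L k : y ^+ k * a ^+ (p + k) = a ^+ p.
  elim: k => [|k IH]; first by rewrite mul1r addn0.
  by rewrite -addSnnS exprD [y ^+ _]exprSr mulrA -(mulrA (y ^+ k)) hy -mulrA -exprD.
have Z k : a ^+ (k + p) * z ^+ k = a ^+ p.
  elim: k => [|k IH]; first by rewrite mulr1.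
  by rewrite addSnnS exprD [z ^+ _]exprS mulrA -(mulrA (a ^+ k)) hz -exprD.
have yz k : y ^+ k * a ^+ p = a ^+ p * z ^+ k.
  by rewrite -{1}(Z k) mulrA addnC L.
have da : y ^+ p.+1 * a ^+ p * a = y ^+ p * a ^+ p.
  by rewrite -mulrA -exprSr exprSr -mulrA hy.
have ad : a * (y ^+ p.+1 * a ^+ p) = y ^+ p * a ^+ p.
  by rewrite yz mulrA -exprS [z ^+ _]exprS mulrA hz yz.
exists (y ^+ p.+1 * a ^+ p); split; last by rewrite da ad.
- by rewrite exprSr -mulrA ad yz mulrA -exprD Z.
- by rewrite da (yz p.+1) mulrA -(mulrA (y ^+ p)) -exprD L.
Qed.

Lemma ring_drazin_unique (R : pzRingType) (a d e : R) p :
  [/\ a ^+ p.+1 * d = a ^+ p, d * a * d = d & d * a = a * d] ->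
  [/\ a ^+ p.+1 * e = a ^+ p, e * a * e = e & e * a = a * e] -> d = e.
Proof.
have idem x : x * a * x = x -> forall k, (a * x) ^+ k.+1 = a * x.
  move=> xax; elim=> [|k IH]; first by rewrite expr1.
  by rewrite exprS IH -mulrA (mulrA x) xax.
move=> [d1 d2 d3] [e1 e2 e3].
have cd : GRing.comm a d by rewrite /GRing.comm d3.
have ce : GRing.comm a e by rewrite /GRing.comm e3.
have absorb x : a ^+ p.+1 * x = a ^+ p -> a ^+ p.+1 * (a * x) = a ^+ p.+1.
  by move=> x1; rewrite mulrA -exprSr exprS -mulrA x1 -exprS.
have dde : a * d = a * d * (a * e).
  rewrite -(idem d d2 p) -d3 exprMn_comm; last exact: commr_sym.
  by rewrite -mulrA absorb.
have ede : a * e = a * d * (a * e).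
  rewrite -(idem e e2 p) exprMn_comm // mulrA; congr (_ * _).
  have cad : GRing.comm (a * d) a by rewrite /GRing.comm -mulrA d3.
  by rewrite (commrX p.+1 cad) absorb.
have de : a * d = a * e by rewrite dde -ede.
by rewrite -d2 -mulrA de mulrA d3 de -e3 e2.
Qed.

(* Existence and uniqueness of the Drazin inverse: the default 0 is never used. *)
Lemma drazinP n (A : 'M[F]_n) : is_drazin A (drazin A).
Proof.
suff: exists D, is_drazin A D by exact: xgetPex.
rewrite /is_drazin; move: (mx_indexP A) => [+ _]; move: (mx_index A) => p rk.
have [y hy] : exists y, y * A ^+ p.+1 = A ^+ p.
  have /submxP[y hy] : (A ^+ p <= A ^+ p.+1)%MS.
    by rewrite -(geq_leqif (mxrank_leqif_sup _)) ?rk // exprS submxMl.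
  by exists y.
have [z hz] : exists z, A ^+ p.+1 * z = A ^+ p.
  have /submxP[z hz] : ((A ^+ p)^T <= (A ^+ p.+1)^T)%MS.
    rewrite -(geq_leqif (mxrank_leqif_sup _)) ?mxrank_tr ?rk //.
    by rewrite exprSr trmx_mul submxMl.
  by exists z^T; apply: trmx_inj; rewrite hz trmx_mul trmxK.
exact: ring_drazin_exists hy hz.
Qed.

Lemma drazin_unique n (A D : 'M[F]_n) : is_drazin A D -> D = drazin A.
Proof. by move=> hD; apply: (ring_drazin_unique hD (drazinP A)). Qed.

End MatrixEquation.

(* Main.v *)
(* Write X = S Y S^-1 and C = S diag(c) S^-1.  Conjugating (E) by S decouples
   it into the scalar equations Gamma_rs y_rs = c_r delta_rs.  Consistency
   forces c_r = 0 whenever Gamma_rr = 0, so that the diagonal choice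
   y_rr = c_r / Gamma_rr (with x / 0 = 0) is a particular solution, and it is
   Xhat because sum_j A_j B_j = S diag(Gamma_rr) S^-1. *)

Require Import Defs.
From mathcomp Require Import all_boot all_order all_algebra complex.
From mathcomp Require Import boolp classical_sets functions cardinality reals.

Set Implicit Arguments.
Unset Strict Implicit.
Unset Printing Implicit Defensive.

Local Open Scope complex_scope.
Local Open Scope classical_set_scope.
Local Open Scope ring_scope.

Import GRing.Theory Num.Theory.

(** * Matrices diagonalized by a fixed [S], and their Drazin inverses *)

Section Diagonalizers.
Context {F : fieldType} {n : nat}.
Implicit Types (M S Y Z : 'M[F]_n) (d : 'rV[F]_n).

Lemma mul_conjmx S Y Z : S \in unitmx ->
  (S *m Y *m invmx S) *m (S *m Z *m invmx S) = S *m (Y *m Z) *m invmx S.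
Proof. by move=> uS; rewrite !mulmxA mulmxKV. Qed.

Lemma conjmx_inj S : S \in unitmx ->
  injective (fun Y => S *m Y *m invmx S).
Proof.
move=> uS Y Z /(congr1 (fun M => invmx S *m (M *m S))).
by rewrite !mulmxKV // !mulKmx.
Qed.

Lemma conj_invmxK S M : S \in unitmx ->
  S *m (invmx S *m M *m S) *m invmx S = M.
Proof. by move=> uS; rewrite -mulmxA mulmxK // mulKVmx. Qed.

Lemma diagonalizersE M S : diagonalizers M S ->
  M = S *m diag_mx (diag_vec M S) *m invmx S.
Proof. by move=> dM; rewrite diag_vecP // conj_invmxK //; case: dM. Qed.

Lemma diagonalizers_conj_diag S d : S \in unitmx ->
  diagonalizers (S *m diag_mx d *m invmx S) S.
Proof.
by move=> uS; split=> //; rewrite -!mulmxA mulVmx // mulmx1 mulKmx.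
Qed.

Lemma diagonalizers_comm M1 M2 S :
  diagonalizers M1 S -> diagonalizers M2 S -> comm_mx M1 M2.
Proof.
move=> d1 d2; have [uS _] := d1.
rewrite /comm_mx (diagonalizersE d1) (diagonalizersE d2).
by rewrite !mul_conjmx // diag_mxC.
Qed.

Lemma diagonalizers_diagonalizable M S : diagonalizers M S -> diagonalizable M.
Proof.
(* [diagonalizable] asks for [P] with P M P^-1 diagonal, so the witness is the inverse of [S]. *)
case=> uS dM; exists (invmx S); rewrite ?unitmx_inv //.
by apply/similar_diagP; rewrite ?unitmx_inv ?invmxK //; apply/is_diag_mxP.
Qed.

(* The convention 0^-1 = 0 makes the entrywise inverse the Drazin inverse of a
   diagonal matrix. *)
Lemma drazin_conj_diag S d : S \in unitmx ->
  drazin (S *m diag_mx d *m invmx S) =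
  S *m diag_mx (\row_i (d 0 i)^-1) *m invmx S.
Proof.
move=> uS; set A := S *m _ *m _; set D := RHS; apply/esym/drazin_unique.
have DA : D *m A = A *m D by rewrite !mul_conjmx // diag_mxC.
have AAD : A *m (A *m D) = A.
  rewrite !mul_conjmx // !mulmx_diag; congr (_ *m diag_mx _ *m _).
  apply/rowP=> i; rewrite !mxE; have [->|di] := eqVneq (d 0 i) 0.
    by rewrite mul0r.
  by rewrite divff // mulr1.
split=> //; last first.
  rewrite !mul_conjmx // !mulmx_diag; congr (_ *m diag_mx _ *m _).
  apply/rowP=> i; rewrite !mxE; have [->|di] := eqVneq (d 0 i) 0.
    by rewrite invr0 !mul0r.
  by rewrite mulVf // mul1r.
(* The index need not be computed. If it is 0, [A] has full rank, so [AAD] cancels to A D = 1; if it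
   is positive, the power identity is [AAD] multiplied on the left by a power of [A]. *)
have [] := mx_indexP A; case: (mx_index A) => [|p] + _.
  rewrite !expr1 expr0 mxrank1 => /eqP rA; have uA : A \in unitmx.
    by rewrite -row_full_unit /row_full rA.
  by rewrite -[LHS](mulKmx uA) AAD mulVmx.
move=> _; rewrite [A ^+ p.+2]exprSr [A ^+ p.+1]exprSr.
by rewrite -[LHS]mulmxA -[LHS]mulmxA AAD.
Qed.

End Diagonalizers.

(** * The equation in the eigenbasis [S], and the zero pattern of the relevant matrix *)

Section RelevantMatrix.
Context {F : fieldType} {n k : nat}.
Variables (A B : 'I_k -> 'M[F]_n) (C S : 'M[F]_n).
Hypothesis hS : codiagonalizers (coef_set A B C) S.

Let Gamma := relevant_mx A B S.
Let Xhat := drazin (coef_prod A B) *m C.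

Let dA j : diagonalizers (A j) S.
Proof. by apply: hS; left; left; exists j. Qed.

Let dB j : diagonalizers (B j) S.
Proof. by apply: hS; left; right; exists j. Qed.

Let dC : diagonalizers C S.
Proof. by apply: hS; right. Qed.

Let uS : S \in unitmx.
Proof. by case: dC. Qed.

(** A diagonal matrix on the left scales rows and one on the right scales columns, so the conjugated
    left-hand side has entries sum_j a^j_r y_rs b^j_s: it is the Hadamard product of [Gamma] and
    [Y]. *)
Lemma conj_solutionsP Y : solutions A B C (S *m Y *m invmx S) <->
  forall r s, Gamma r s * Y r s = diag_vec C S 0 r *+ (r == s).
Proof.
have -> : solutions A B C (S *m Y *m invmx S) =
    (\matrix_(r, s) (Gamma r s * Y r s) = diag_mx (diag_vec C S)).
  rewrite /solutions /= {1}(diagonalizersE dC); apply/propext.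
  have -> : \sum_(j < k) A j *m (S *m Y *m invmx S) *m B j =
      S *m (\matrix_(r, s) (Gamma r s * Y r s)) *m invmx S.
    transitivity (\sum_(j < k) S *m (diag_mx (diag_vec (A j) S) *m Y *m
        diag_mx (diag_vec (B j) S)) *m invmx S).
      apply: eq_bigr => j _.
      rewrite {1}(diagonalizersE (dA j)) {1}(diagonalizersE (dB j)).
      by rewrite !mul_conjmx.
    rewrite -mulmx_suml -mulmx_sumr; congr (_ *m _ *m _).
    apply/matrixP=> r s; rewrite summxE !mxE mulr_suml.
    by apply: eq_bigr => j _; rewrite mul_diag_mx mul_mx_diag !mxE mulrAC.
  by split=> [/conjmx_inj-> //|->].
by split=> [/matrixP e r s|e]; [|apply/matrixP=> r s];
  have := e r s; rewrite !mxE.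
Qed.

Lemma conj_hom_spaceP Y : hom_space A B S (S *m Y *m invmx S) <->
  forall r s, Gamma r s != 0 -> Y r s = 0.
Proof.
by split=> [[Z hZ /conjmx_inj<-]|] //; exists Y.
Qed.

Lemma hom_space_submod_closed : GRing.submod_closed (mem (hom_space A B S)).
Proof.
split=> [|a u v]; rewrite !inE.
  by exists 0; rewrite ?mulmx0 ?mul0mx // => r s _; rewrite mxE.
move=> [Y hY <-] [Z hZ <-]; exists (a *: Y + Z).
  by move=> r s g; rewrite !mxE hY // hZ // mulr0 addr0.
by rewrite mulmxDr mulmxDl -scalemxAr -scalemxAl.
Qed.

(** The r-th eigenvalue of A_j B_j is a^j_r b^j_r, and summing over j gives [Gamma r r]. This ties
    the standard equation to the diagonal of the relevant matrix. *)
Lemma conj_coef_prod :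
  coef_prod A B = S *m diag_mx (\row_r Gamma r r) *m invmx S.
Proof.
transitivity (\sum_(j < k) S *m diag_mx (\row_r (diag_vec (A j) S 0 r *
    diag_vec (B j) S 0 r)) *m invmx S).
  apply: eq_bigr => j _.
  rewrite {1}(diagonalizersE (dA j)) {1}(diagonalizersE (dB j)).
  by rewrite mul_conjmx // mulmx_diag.
rewrite -mulmx_suml -mulmx_sumr -raddf_sum; congr (_ *m diag_mx _ *m _).
by apply/rowP=> r; rewrite summxE !mxE; apply: eq_bigr => j _; rewrite mxE.
Qed.

Lemma conj_Xhat : Xhat =
  S *m diag_mx (\row_r ((Gamma r r)^-1 * diag_vec C S 0 r)) *m invmx S.
Proof.
rewrite /Xhat conj_coef_prod drazin_conj_diag // {1}(diagonalizersE dC).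
rewrite mul_conjmx // mulmx_diag; congr (_ *m diag_mx _ *m _).
by apply/rowP=> r; rewrite !mxE.
Qed.

Lemma solutionsE : solutions A B C !=set0 ->
  solutions A B C = [set Xhat + H | H in hom_space A B S].
Proof.
case=> X0; rewrite -(conj_invmxK X0 uS) => /conj_solutionsP sol0.
have c0 r : Gamma r r = 0 -> diag_vec C S 0 r = 0.
  by move=> g0; have := sol0 r r; rewrite g0 mul0r eqxx mulr1n.
have solP Y : solutions A B C (Xhat + S *m Y *m invmx S) <->
    hom_space A B S (S *m Y *m invmx S).
  rewrite conj_Xhat -mulmxDl -mulmxDr conj_solutionsP conj_hom_spaceP.
  have hatP r s : Gamma r s * (diag_mx (\row_r ((Gamma r r)^-1 *
      diag_vec C S 0 r))) r s = diag_vec C S 0 r *+ (r == s).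
    (* Generalizing keeps [mxE] from unfolding the entries of [Gamma] and of the spectrum of [C]. *)
    move: (Gamma) (diag_vec C S) c0 => G c c0; rewrite !mxE.
    have [<-|rs] := eqVneq r s; last by rewrite mulr0.
    rewrite !mulr1n; have [g0|g0] := eqVneq (G r r) 0; last by rewrite mulVKf.
    by rewrite g0 mul0r c0.
  split=> [e r s g|e r s].
    (* Subtracting the scalar equation of the particular solution leaves Gamma_rs y_rs = 0. *)
    apply: (mulfI g); apply: (addrI (diag_vec C S 0 r *+ (r == s))).
    by rewrite -{1}hatP -mulrDr mulr0 addr0 -e [fun_of_matrix (_ + _) r s]mxE.
  rewrite [fun_of_matrix (_ + _) r s]mxE mulrDr hatP.
  have [->|/e->] := eqVneq (Gamma r s) 0.
    by rewrite mul0r addr0.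
  by rewrite mulr0 addr0.
apply/seteqP; split=> [X solX|_ [_ [Y hY <-] <-]]; last first.
  by apply/solP/conj_hom_spaceP.
exists (X - Xhat); last by rewrite addrC subrK.
rewrite -(conj_invmxK (X - Xhat) uS); apply/solP.
by rewrite conj_invmxK // addrC subrK.
Qed.

Lemma solutions_unique : solutions A B C !=set0 ->
  solutions A B C = [set Xhat] <-> forall r s, Gamma r s != 0.
Proof.
move=> /solutionsE->; split=> [e r s|g]; last first.
  apply/seteqP; split=> [_ [_ [Y hY <-] <-]|_ ->].
    have -> : Y = 0 by apply/matrixP=> r s; rewrite mxE hY.
    by rewrite mulmx0 mul0mx addr0.
  exists 0; rewrite ?addr0 //.
  by have [] := hom_space_submod_closed; rewrite inE.
apply/negP=> /eqP g0.
(* At a zero of [Gamma] the conjugated matrix unit is a nonzero homogeneous solution, so [Xhat] plus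
   it would be a second solution. *)
have hD : hom_space A B S (S *m delta_mx r s *m invmx S).
  apply/conj_hom_spaceP => i j gij; rewrite mxE.
  by case: andP => // -[/eqP ir /eqP js]; rewrite ir js g0 eqxx in gij.
have XD : [set Xhat] (Xhat + S *m delta_mx r s *m invmx S).
  by rewrite -e; exists (S *m delta_mx r s *m invmx S).
have : S *m delta_mx r s *m invmx S = S *m 0 *m invmx S.
  by apply: (addrI Xhat); rewrite mulmx0 mul0mx addr0.
move=> /(conjmx_inj uS)/matrixP/(_ r s)/eqP.
by rewrite !mxE !eqxx oner_eq0.
Qed.

(** Only diagonal entries of [Y] remain free, and [Xhat] is itself diagonal in the basis [S]. *)
Lemma solutions_off_diagonal : solutions A B C !=set0 ->
  (forall r s, r != s -> Gamma r s != 0) ->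
  forall X, solutions A B C X -> diagonalizers X S.
Proof.
move=> /solutionsE-> g _ [_ [Y hY <-] <-].
have /diag_mxP[d ->] : is_diag_mx Y.
  by apply/is_diag_mxP => r s rs; apply: hY; apply: g.
by rewrite conj_Xhat -mulmxDl -mulmxDr -raddfD; apply: diagonalizers_conj_diag.
Qed.

(** Sharing the diagonalizer [S], [X] commutes with each B_j, so A_j X B_j = A_j B_j X. *)
Lemma diagonalizers_std_solutions X : diagonalizers X S ->
  solutions A B C X -> std_solutions A B C X.
Proof.
move=> dX <-; rewrite /std_solutions /= /coef_prod mulmx_suml.
apply: eq_bigr => j _.
by rewrite -!mulmxA; congr (_ *m _); apply: diagonalizers_comm (dB j) dX.
Qed.

(** The determinant of sum_j A_j B_j is the product of the diagonal entries of [Gamma], up to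
    conjugation by [S], so the coefficient matrix is invertible. *)
Lemma std_solutions_subsingleton : (forall r, Gamma r r != 0) ->
  std_solutions A B C `<=` [set invmx (coef_prod A B) *m C].
Proof.
move=> g X /= <-; rewrite mulKmx // conj_coef_prod.
rewrite !unitmx_mul unitmx_inv uS andbT /= unitmxE det_diag unitfE.
by apply/prodf_neq0 => i _; rewrite mxE.
Qed.

End RelevantMatrix.

(** A zero of [Gamma] leaves one entry of [Y] free, and in characteristic zero its natural-number
    values already give infinitely many solutions. *)
Lemma solutions_infinite (F : numFieldType) n k (A B : 'I_k -> 'M[F]_n)
    (C S : 'M[F]_n) r s :
  codiagonalizers (coef_set A B C) S -> solutions A B C !=set0 ->
  relevant_mx A B S r s = 0 -> infinite_set (solutions A B C).
Proof.
move=> hS ne g0; have uS : S \in unitmx by case: (hS C) => //; right.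
rewrite (solutionsE hS ne) => fin; apply: infinite_nat.
pose Xhat := drazin (coef_prod A B) *m C.
pose f m := Xhat + S *m (m%:R *: delta_mx r s) *m invmx S.
have f_inj : injective f.
  move=> p q /addrI/(conjmx_inj uS)/matrixP/(_ r s)/eqP.
  by rewrite !mxE !eqxx !mulr1 eqr_nat => /eqP.
(* The preimage of a finite solution set under the injective [f] would be finite, yet it is all of
   [nat]. *)
apply: sub_finite_set (finite_preimage (in2W f_inj) fin) => m _.
exists (S *m (m%:R *: delta_mx r s) *m invmx S) => //.
apply/(conj_hom_spaceP hS) => i j gij; rewrite [LHS]mxE [delta_mx _ _ _ _]mxE.
case: andP => [[/eqP ir /eqP js]|_]; last by rewrite mulr0.
by rewrite ir js g0 eqxx in gij.
Qed.

Theorem theorem2p6 (R : realType) (n k : nat) (hn : (0 < n)%N) (hk : (0 < k)%N)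
    (A B : 'I_k -> 'M[R[i]]_n) (C : 'M[R[i]]_n)
    (Ncomm : commuting_set (coef_set A B C))
    (Ndiag : diagonalizable_set (coef_set A B C))
    (consistent : solutions A B C !=set0)
    (S : 'M[R[i]]_n) (hS : codiagonalizers (coef_set A B C) S) :
  let Gamma := relevant_mx A B S in
  let Xhat := drazin (coef_prod A B) *m C in
  let Xh := hom_space A B S in
  let X := [set Xhat + H | H in Xh] in
  [/\ (* (i) *)
      solutions A B C = X /\ GRing.submod_closed (mem Xh),
      (* (ii) *)
      solutions A B C = [set Xhat] <-> forall r s, Gamma r s != 0,
      (* (iii) *)
      infinite_set (std_solutions A B C) -> infinite_set (solutions A B C)
    & (* (iv) *)
      (forall r s, r != s -> Gamma r s != 0) ->
      [/\ commuting_set (coef_set A B C `|` X),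
          diagonalizable_set (coef_set A B C `|` X)
        & X `<=` std_solutions A B C] ].
Proof.
move=> Gamma Xhat Xh X.
have eX : solutions A B C = X := solutionsE hS consistent.
split.
- by split=> //; apply: hom_space_submod_closed.
- exact: solutions_unique.
(* Either a diagonal zero of [Gamma] gives a free entry, or the standard equation has at most one
   solution, contradicting [inf]. *)
- move=> inf; have [r g0|g] := pselect (exists r, Gamma r r = 0).
    by case: r g0 => r; apply: solutions_infinite.
  case: inf; apply: sub_finite_set (finite_set1 _).
  apply: (std_solutions_subsingleton hS) => r; apply/negP => /eqP g0.
  by apply: g; exists r.
move=> g; have dX Y : X Y -> diagonalizers Y S.
  by rewrite -eX; apply: solutions_off_diagonal.
(* One [S] diagonalizes the whole union, which yields both commutation and diagonalizability. *)
have dN Y : (coef_set A B C `|` X) Y -> diagonalizers Y S by case=> [/hS|/dX].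
split.
- by move=> M1 M2 /dN d1 /dN d2; apply: diagonalizers_comm d1 d2.
- by move=> M /dN; apply: diagonalizers_diagonalizable.
- by move=> Y XY; apply: (diagonalizers_std_solutions hS (dX _ XY)); rewrite eX.
Qed.
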